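(* Let $B_{10}$ be the Bayes factor of $H_1:\boldsymbol\theta\neq\mathbf 0$ against $H_0:\boldsymbol\theta=\mathbf 0$ under the independent semi-conjugate priors, i.e. $$B_{10}=C_2\,\frac{\displaystyle\int\left(\nu_1s_1^2+s_{\mathbf y}^2+(\boldsymbol\theta-\hat{\boldsymbol\theta})'\mathbf X_{\boldsymbol\theta}'\boldsymbol\Sigma^{-1}\mathbf X_{\boldsymbol\theta}(\boldsymbol\theta-\hat{\boldsymbol\theta})\right)^{-\frac{n-r_2+\nu_1}{2}}N_{\boldsymbol\theta}(\mathbf 0,\boldsymbol\Omega)\,d\boldsymbol\theta}{\left(\nu_0s_0^2+s_{\mathbf y}^2+\hat{\boldsymbol\theta}'\mathbf X_{\boldsymbol\theta}'\boldsymbol\Sigma^{-1}\mathbf X_{\boldsymbol\theta}\hat{\boldsymbol\theta}\right)^{-\frac{n-r_2+\nu_0}{2}}},$$ $$C_2=\frac{(\nu_1/2)^{\nu_1/2}s_1^{\nu_1}\,\Gamma\left(\frac{\nu_0}{2}\right)\Gamma\left(\frac{n+\nu_1-r_2}{2}\right)}{(\nu_0/2)^{\nu_0/2}s_0^{\nu_0}\,\Gamma\left(\frac{\nu_1}{2}\right)\Gamma\left(\frac{n+\nu_0-r_2}{2}\right)}\,2^{(\nu_1-\nu_0)/2},$$ where $N_{\boldsymbol\theta}(\mathbf 0,\boldsymbol\Omega)$ is the multivariate normal density at $\boldsymbol\theta$ with mean $\mathbf 0$ and covariance matrix $\boldsymbol\Omega$. Then, as $|\hat{\boldsymbol\theta}|\to\infty$,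 $$B_{10}\to\begin{cases}0&\text{if }\nu_0<\nu_1,\\ 1&\text{if }\nu_0=\nu_1,\\ \infty&\text{if }\nu_0>\nu_1.\end{cases}$$
   Context: Model: $\mathbf y=\mathbf X_{\boldsymbol\theta}\boldsymbol\theta+\mathbf X_{\boldsymbol\gamma}\boldsymbol\gamma+\boldsymbol\epsilon$, $\boldsymbol\epsilon\sim N(\mathbf 0,\sigma^2\boldsymbol\Sigma)$, with $\mathbf y\in\mathbb R^n$, $\boldsymbol\theta\in\mathbb R^{r_1}$ ($r_1\ge1$) the tested parameters, $\boldsymbol\gamma\in\mathbb R^{r_2}$ ($r_2\ge0$) nuisance parameters, $n>r_1+r_2$, $\sigma^2$ unknown, $\boldsymbol\Sigma$ a known positive definite matrix, $[\mathbf X_{\boldsymbol\theta}\ \mathbf X_{\boldsymbol\gamma}]$ of full column rank, and (by the choice of parametrization) $\mathbf X_{\boldsymbol\theta}'\boldsymbol\Sigma^{-1}\mathbf X_{\boldsymbol\gamma}=\mathbf 0$. $\hat{\boldsymbol\theta}=(\mathbf X_{\boldsymbol\theta}'\boldsymbol\Sigma^{-1}\mathbf X_{\boldsymbol\theta})^{-1}\mathbf X_{\boldsymbol\theta}'\boldsymbol\Sigma^{-1}\mathbf y$ is the ML estimate of $\boldsymbol\theta$, $\hat{\boldsymbol\gamma}$ is the ML estimate of $\boldsymbol\gamma$, and $s_{\mathbf y}^2=(\mathbf y-\mathbf X_{\boldsymbol\theta}\hat{\boldsymbol\theta}-\mathbf X_{\boldsymbol\gamma}\hat{\boldsymbol\gamma})'\boldsymbol\Sigma^{-1}(\mathbf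 y-\mathbf X_{\boldsymbol\theta}\hat{\boldsymbol\theta}-\mathbf X_{\boldsymbol\gamma}\hat{\boldsymbol\gamma})$. Independent semi-conjugate priors: under $H_1$, independently, $\boldsymbol\theta\sim N(\mathbf 0,\boldsymbol\Omega)$ ($\boldsymbol\Omega$ positive definite), $\pi_1(\boldsymbol\gamma_1)\propto1$, $\sigma_1^2\sim\text{inv-}\chi^2(s_1^2,\nu_1)$; under $H_0$, independently, $\pi_0(\boldsymbol\gamma_0)\propto1$, $\sigma_0^2\sim\text{inv-}\chi^2(s_0^2,\nu_0)$. Here subscripts on parameters indicate the hypothesis, $\nu_t\ge0$ and $s_t>0$ for $t=0,1$, and $\text{inv-}\chi^2(s^2,\nu)$ is the scaled inverse chi-squared distribution, with density proportional to $(\sigma^2)^{-\nu/2-1}e^{-\nu s^2/(2\sigma^2)}$; $\nu_t=0$ denotes the improper prior $\pi_t(\sigma_t^2)\propto\sigma_t^{-2}$, in which case the factor $(\nu_t/2)^{\nu_t/2}s_t^{\nu_t}/\Gamma(\nu_t/2)$ in $C_2$ is read as $1$. The limit is taken with all other quantities ($n$, the design, $\boldsymbol\Sigma$, $\boldsymbol\Omega$, $s_t$, $\nu_t$, $s_{\mathbf y}^2$) fixed.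
   Formalization: For ν0=ν1 the stated limit 1 is false when s0≠s1 and ν1>0; the formal limit is (s1/s0)^ν1, which is 1 if s0=s1 or ν1=0. Also assumed: ν1 s1²+s_y²>0, excluding only ν1=0 with s_y²=0, where the integral diverges. *)

(* Defs.v *)
From HB Require Import structures.
From mathcomp Require Import all_boot all_order all_algebra.
From mathcomp Require Import all_classical all_reals all_analysis.
From mathcomp Require Import ring.
Set Implicit Arguments.
Unset Strict Implicit.
Unset Printing Implicit Defensive.
Import Order.TTheory GRing.Theory Num.Theory.
Import numFieldNormedType.Exports.
Local Open Scope classical_set_scope.
Local Open Scope ring_scope.

Definition qform (R : realType) (n : nat) (A : 'M[R]_n) (x : 'cV[R]_n) : R :=
  (x^T *m A *m x) 0 0.

Definition posdef (R : realType) (n : nat) (A : 'M[R]_n) : Prop :=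
  A^T = A /\ forall x : 'cV[R]_n, x != 0 -> 0 < qform A x.

(* The canonical norm on matrices is the sup norm. *)
Definition enorm (R : realType) (n : nat) (x : 'cV[R]_n) : R :=
  Num.sqrt (\sum_(i < n) x i 0 ^+ 2).

Definition Gamma (R : realType) (x : R) : R :=
  \int[@lebesgue_measure R]_(t in `]0, +oo[) (t `^ (x - 1) * expR (- t)).

Definition cons_tuple (R : realType) (n : nat)
    (p : measurableTypeR R * n.-tuple (measurableTypeR R)) :
    n.+1.-tuple (measurableTypeR R) :=
  [tuple of p.1 :: p.2].

(* Lebesgue measure on R^n, with R^n represented by n-tuples, which carry the
   product sigma-algebra; see [lebesgue_tuple_spec]. *)
Fixpoint lebesgue_tuple (R : realType) (n : nat) :
    set (n.-tuple (measurableTypeR R)) -> \bar R :=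
  match n with
  | 0 => \d_ [tuple]
  | m.+1 => pushforward (@lebesgue_measure R \x @lebesgue_tuple R m)%E
      (@cons_tuple R m)
  end.

Definition col_of_tuple (R : realType) (n : nat)
    (t : n.-tuple (measurableTypeR R)) : 'cV[R]_n :=
  \col_(i < n) tnth t i.

Definition integral_Rn (R : realType) (n : nat) (f : 'cV[R]_n -> \bar R) :
    \bar R :=
  (\int[@lebesgue_tuple R n]_t f (col_of_tuple t))%E.

Definition mvnormal_pdf (R : realType) (n : nat) (m : 'cV[R]_n) (S : 'M[R]_n)
    (x : 'cV[R]_n) : R :=
  (Num.sqrt ((2 * pi) ^+ n * \det S))^-1 * expR (- (qform (invmx S) (x - m) / 2)).

Definition likelihood (R : realType) (n r1 r2 : nat) (Sigma : 'M[R]_n)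
    (Xt : 'M[R]_(n, r1)) (Xg : 'M[R]_(n, r2)) (y : 'cV[R]_n)
    (theta : 'cV[R]_r1) (gamma : 'cV[R]_r2) (sigma2 : R) : R :=
  mvnormal_pdf (Xt *m theta + Xg *m gamma) (sigma2 *: Sigma) y.

(* When Xt^T Sigma^-1 Xg = 0, the maximum likelihood estimates of theta and
   gamma are [gls Sigma Xt y] and [gls Sigma Xg y]; see [gls_max_likelihood]. *)
Definition gls (R : realType) (n r : nat) (Sigma : 'M[R]_n)
    (X : 'M[R]_(n, r)) (y : 'cV[R]_n) : 'cV[R]_r :=
  invmx (X^T *m invmx Sigma *m X) *m X^T *m invmx Sigma *m y.

Definition ssr (R : realType) (n r1 r2 : nat) (Sigma : 'M[R]_n)
    (Xt : 'M[R]_(n, r1)) (Xg : 'M[R]_(n, r2)) (y : 'cV[R]_n) : R :=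
  qform (invmx Sigma) (y - Xt *m gls Sigma Xt y - Xg *m gls Sigma Xg y).

(* Normalising constant of the scaled inverse chi-squared density
   x |-> x^(-nu/2-1) exp(-nu s^2/(2 x)); it is set to 1 for nu = 0, the
   improper prior 1/x. *)
Definition invchi2_const (R : realType) (s nu : R) : R :=
  if nu == 0 then 1 else (nu / 2) `^ (nu / 2) * s `^ nu / Gamma (nu / 2).

Definition C2 (R : realType) (n r2 : nat) (s0 nu0 s1 nu1 : R) : R :=
  invchi2_const s1 nu1 / invchi2_const s0 nu0
  * (Gamma ((n%:R + nu1 - r2%:R) / 2) / Gamma ((n%:R + nu0 - r2%:R) / 2))
  * 2 `^ ((nu1 - nu0) / 2).

(* Bayes factor of theta != 0 against theta = 0, once gamma and sigma^2 have
   been integrated out of the two marginal likelihoods.  It is extended-real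
   valued so that a divergent integral over theta would count as +oo. *)
Definition B10 (R : realType) (n r1 r2 : nat) (Sigma : 'M[R]_n)
    (Xt : 'M[R]_(n, r1)) (Xg : 'M[R]_(n, r2)) (Omega : 'M[R]_r1)
    (s0 nu0 s1 nu1 : R) (y : 'cV[R]_n) : \bar R :=
  let M := Xt^T *m invmx Sigma *m Xt in
  let thetahat := gls Sigma Xt y in
  let sy2 := ssr Sigma Xt Xg y in
  ((C2 n r2 s0 nu0 s1 nu1)%:E *
   (integral_Rn (fun theta : 'cV[R]_r1 =>
      ((nu1 * s1 ^+ 2 + sy2 + qform M (theta - thetahat))
         `^ (- ((n%:R - r2%:R + nu1) / 2))
       * mvnormal_pdf 0 Omega theta)%:E) *
    (((nu0 * s0 ^+ 2 + sy2 + qform M thetahat)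
        `^ (- ((n%:R - r2%:R + nu0) / 2)))^-1)%:E))%E.

(* The filter, on the data y, of "|thetahat| tends to infinity with s_y^2 = c
   held fixed". *)
Definition thetahat_infty (R : realType) (n r1 r2 : nat) (Sigma : 'M[R]_n)
    (Xt : 'M[R]_(n, r1)) (Xg : 'M[R]_(n, r2)) (c : R) :
    set_system 'cV[R]_n :=
  filter_from setT (fun A : R =>
    [set y | ssr Sigma Xt Xg y = c /\ A < enorm (gls Sigma Xt y)]).

Lemma posdef_unitmx (R : realType) (n : nat) (A : 'M[R]_n) :
  posdef A -> A \in unitmx.
Proof.
move=> [_ Apos]; rewrite unitmxE unitfE; apply/negP => /det0P[v v0 vA].
have : v^T != 0 by rewrite -trmx0 (inj_eq trmx_inj).
by move=> /Apos; rewrite /qform trmxK vA mul0mx mxE ltxx.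
Qed.

Lemma posdef_invmx (R : realType) (n : nat) (A : 'M[R]_n) :
  posdef A -> posdef (invmx A).
Proof.
move=> Apd; have uA := posdef_unitmx Apd; have [As Apos] := Apd.
split=> [|x x0]; first by rewrite trmx_inv As.
have Ax0 : invmx A *m x != 0.
  by apply: contra_neq x0 => e; rewrite -(mulKVmx uA x) e mulmx0.
have := Apos _ Ax0.
by rewrite /qform trmx_mul trmx_inv As -!mulmxA mulKVmx.
Qed.

Lemma posdef_qform_ge0 (R : realType) (n : nat) (A : 'M[R]_n) (x : 'cV[R]_n) :
  posdef A -> 0 <= qform A x.
Proof.
move=> [_ Apos]; have [->|/Apos/ltW//] := eqVneq x 0.
by rewrite /qform mulmx0 mxE.
Qed.

Lemma posdef_gram (R : realType) (n r : nat) (A : 'M[R]_n) (X : 'M[R]_(n, r)) :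
  posdef A -> \rank X = r -> posdef (X^T *m A *m X).
Proof.
move=> [As Apos] rX; split=> [|x x0].
  by rewrite !trmx_mul trmxK As mulmxA.
have /row_fullP[B BX] : row_full X by rewrite /row_full rX.
have Xx0 : X *m x != 0.
  by apply: contra_neq x0 => e; rewrite -(mul1mx x) -BX -mulmxA e mulmx0.
by have := Apos _ Xx0; rewrite /qform trmx_mul !mulmxA.
Qed.

Lemma rank_row_mx_full (R : realType) (n r1 r2 : nat) (Xt : 'M[R]_(n, r1))
    (Xg : 'M[R]_(n, r2)) :
  \rank (row_mx Xt Xg) = (r1 + r2)%N -> \rank Xt = r1 /\ \rank Xg = r2.
Proof.
move=> rX; have /row_fullP[B] : row_full (row_mx Xt Xg) by rewrite /row_full rX.
rewrite mul_mx_row -(vsubmxK B) !mul_col_mx -[1%:M]submxK.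
rewrite -block_mxEh => /eq_block_mx[+ _ _ +].
rewrite scalar_mx_block block_mxKul block_mxKdr => et eg.
by split; apply/eqP; apply/row_fullP; eexists; [exact: et|exact: eg].
Qed.

Lemma qformD (R : realType) (n : nat) (A : 'M[R]_n) (a b : 'cV[R]_n) :
  A^T = A -> b^T *m A *m a = 0 -> qform A (a + b) = qform A a + qform A b.
Proof.
move=> As ba0; have ab0 : a^T *m A *m b = 0.
  by apply: trmx_inj; rewrite !trmx_mul trmxK As mulmxA ba0 trmx0.
rewrite /qform [(_ + _)^T]linearD/= !mulmxDl !mulmxDr ab0 ba0 add0r addr0.
by rewrite mxE.
Qed.

Section gls_theory.
Context (R : realType) (n r1 r2 : nat) (Sigma : 'M[R]_n).
Context (Xt : 'M[R]_(n, r1)) (Xg : 'M[R]_(n, r2)).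
Hypothesis Sigma_pd : posdef Sigma.
Hypothesis full_rank : \rank (row_mx Xt Xg) = (r1 + r2)%N.
Hypothesis orth : Xt^T *m invmx Sigma *m Xg = 0.

Let S := invmx Sigma.
Let Spd : posdef S. Proof. exact: posdef_invmx. Qed.
Let Ssym : S^T = S. Proof. exact: Spd.1. Qed.

Let orth' : Xg^T *m S *m Xt = 0.
Proof. by apply: trmx_inj; rewrite !trmx_mul trmxK Ssym mulmxA orth trmx0. Qed.

Let ut : Xt^T *m S *m Xt \in unitmx.
Proof. exact/posdef_unitmx/posdef_gram/(rank_row_mx_full full_rank).1. Qed.

Let ug : Xg^T *m S *m Xg \in unitmx.
Proof. exact/posdef_unitmx/posdef_gram/(rank_row_mx_full full_rank).2. Qed.

Lemma gls_residual_orth (y : 'cV[R]_n) (d1 : 'cV[R]_r1) (d2 : 'cV[R]_r2) :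
  (Xt *m d1 + Xg *m d2)^T *m S
    *m (y - Xt *m gls Sigma Xt y - Xg *m gls Sigma Xg y) = 0.
Proof.
have et : Xt^T *m S *m Xt *m gls Sigma Xt y = Xt^T *m S *m y.
  by rewrite /gls !(mulmxA (_ *m S *m _)) mulmxV// mul1mx.
have eg : Xg^T *m S *m Xg *m gls Sigma Xg y = Xg^T *m S *m y.
  by rewrite /gls !(mulmxA (_ *m S *m _)) mulmxV// mul1mx.
set r := y - _ - _.
have rt : Xt^T *m S *m r = 0.
  by rewrite /r !mulmxBr (mulmxA _ Xt) (mulmxA _ Xg) et orth mul0mx subrr subr0.
have rg : Xg^T *m S *m r = 0.
  by rewrite /r !mulmxBr (mulmxA _ Xt) (mulmxA _ Xg) eg orth' mul0mx subr0 subrr.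
rewrite [(_ + _)^T]linearD/= !trmx_mul !mulmxDl.
by rewrite -!(mulmxA _^T) !(mulmxA _ S) rt rg !mulmx0 addr0.
Qed.

Lemma gls_max_likelihood (y : 'cV[R]_n) (theta : 'cV[R]_r1)
    (gamma : 'cV[R]_r2) (sigma2 : R) : 0 < sigma2 ->
  likelihood Sigma Xt Xg y theta gamma sigma2 <=
  likelihood Sigma Xt Xg y (gls Sigma Xt y) (gls Sigma Xg y) sigma2.
Proof.
move=> s0; rewrite /likelihood /mvnormal_pdf.
apply: ler_wpM2l; first by rewrite invr_ge0 sqrtr_ge0.
rewrite ler_expR lerN2 ler_pM2r ?invr_gt0//.
have qZ x : qform (invmx (sigma2 *: Sigma)) x = sigma2^-1 * qform S x.
  rewrite /qform invmxZ; last first.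
    by rewrite unitmxZ ?posdef_unitmx// unitfE gt_eqF.
  by rewrite -scalemxAr -scalemxAl mxE.
rewrite !qZ ler_pM2l ?invr_gt0//.
set th := gls Sigma Xt y; set ga := gls Sigma Xg y.
have -> : y - (Xt *m theta + Xg *m gamma) =
    (y - Xt *m th - Xg *m ga) + (Xt *m (th - theta) + Xg *m (ga - gamma)).
  rewrite !mulmxBr; apply/matrixP => i j; rewrite !mxE.
  by rewrite !opprD !addrA; ring.
rewrite [leRHS]qformD//; last exact: gls_residual_orth.
by rewrite opprD addrA lerDl posdef_qform_ge0.
Qed.

End gls_theory.

Section thetahat_infty_theory.
Context (R : realType) (n r1 r2 : nat) (Sigma : 'M[R]_n).
Context (Xt : 'M[R]_(n, r1)) (Xg : 'M[R]_(n, r2)) (c : R).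

Lemma thetahat_infty_filter : Filter (thetahat_infty Sigma Xt Xg c).
Proof.
apply: filter_from_filter; first by exists 0.
move=> a b _ _; exists (Num.max a b) => // y [yc].
by rewrite gt_max => /andP[ay yb].
Qed.

Lemma thetahat_infty_proper : (0 < r1)%N -> (r1 + r2 < n)%N ->
  posdef Sigma -> \rank (row_mx Xt Xg) = (r1 + r2)%N ->
  Xt^T *m invmx Sigma *m Xg = 0 -> 0 <= c ->
  ProperFilter (thetahat_infty Sigma Xt Xg c).
Proof.
move=> r1_gt0 n_gt Spd rX orth c0; split; last exact: thetahat_infty_filter.
move=> [A _ sub]; set S := invmx Sigma.
have Sipd : posdef S by exact: posdef_invmx.
have [rt rg] := rank_row_mx_full rX.
have ut := posdef_unitmx (posdef_gram Sipd rt).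
have orth' : Xg^T *m S *m Xt = 0.
  by apply: trmx_inj; rewrite !trmx_mul trmxK Sipd.1 mulmxA orth trmx0.
have [e e0 [te ge]] : exists2 e : 'cV[R]_n, e != 0 &
    Xt^T *m S *m e = 0 /\ Xg^T *m S *m e = 0.
  pose K := row_mx (S^T *m Xt) (S^T *m Xg).
  have : kermx K != 0.
    rewrite -mxrank_eq0 mxrank_ker subn_eq0 -ltnNge.
    exact: leq_ltn_trans (rank_leq_col _) n_gt.
  move=> /rowV0Pn[v /sub_kermxP vK v0]; exists v^T.
    by rewrite -trmx0 (inj_eq trmx_inj).
  move: vK; rewrite mul_mx_row -row_mx0 => /eq_row_mx[vt vg].
  by split; apply: trmx_inj; rewrite !trmx_mul !trmxK trmx0 ?vt ?vg.
have qe : 0 < qform S e by exact: Sipd.2.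
pose a := Num.sqrt (c / qform S e).
pose th : 'cV[R]_r1 := const_mx (`|A| + 1).
pose y := Xt *m th + a *: e.
have gt : gls Sigma Xt y = th.
  rewrite /gls -!mulmxA !(mulmxA Xt^T) /y mulmxDr -scalemxAr te scaler0 addr0.
  by rewrite (mulmxA _ Xt) mulKmx.
have gg : gls Sigma Xg y = 0.
  rewrite /gls -!mulmxA !(mulmxA Xg^T) /y mulmxDr -scalemxAr ge scaler0 addr0.
  by rewrite (mulmxA _ Xt) orth' mul0mx mulmx0.
apply: (sub y); split.
  rewrite /ssr gt gg mulmx0 subr0 /y addrC addKr.
  rewrite /qform [(_ *: _)^T]linearZ/= -!scalemxAl -scalemxAr scalerA mxE.
  rewrite -expr2 sqr_sqrtr ?divr_ge0// 1?ltW// -/(qform _ _).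
  by rewrite divfK// gt_eqF.
rewrite gt /enorm (le_lt_trans (ler_norm A))//.
rewrite -(ltr_pXn2r (n := 2))// ?nnegrE ?sqrtr_ge0// sqr_sqrtr; last first.
  by apply: sumr_ge0 => i _; exact: sqr_ge0.
rewrite (bigD1 (Ordinal r1_gt0))//= mxE.
apply: (@lt_le_trans _ _ ((`|A| + 1) ^+ 2)); last first.
  by rewrite lerDl sumr_ge0// => i _; exact: sqr_ge0.
by rewrite ltr_pXn2r// ?nnegrE ?addr_ge0// ltrDl.
Qed.

End thetahat_infty_theory.

Section lebesgue_box.
Context (R : realType).
Notation T := (measurableTypeR R).

Lemma measurable_cons_tuple n : measurable_fun setT (@cons_tuple R n).
Proof. exact: measurable_cons. Qed.

Definition box n (A : 'I_n -> set T) : set (n.-tuple T) :=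
  [set t | forall i, A i (tnth t i)].

Lemma measurable_box n (A : 'I_n -> set T) :
  (forall i, measurable (A i)) -> measurable (box A).
Proof.
move=> mA; rewrite (_ : box A = \bigcap_(i in [set: 'I_n])
    ((fun t : n.-tuple T => tnth t i) @^-1` A i)); last first.
  by apply/seteqP; split=> [t At i _|t At i]; exact: At.
apply: fin_bigcap_measurable => // i _; rewrite -[X in measurable X]setTI.
exact: measurable_tnth.
Qed.

Lemma sigma_finite_box n (m : set (n.-tuple T) -> \bar R) :
  (forall A : 'I_n -> set T, (forall i, measurable (A i)) ->
    (m (box A) = \prod_(i < n) @lebesgue_measure R (A i))%E) ->
  sigma_finite setT m.
Proof.
move=> mB; pose I (k : nat) : set T := `](- k%:R), k%:R[%classic.
have mI k : measurable (I k) by exact: measurable_itv.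
exists (fun k => box (fun _ : 'I_n => I k)) => [|k].
  apply/seteqP; split=> // t _.
  pose k := (\sum_(i < n) (Num.truncn `|tnth t i|%R).+1)%N.
  exists k => // i; rewrite /I/= in_itv/= -ltr_norml.
  apply: lt_le_trans (truncnS_gt _) _; rewrite ler_nat /k.
  by rewrite (bigD1 i)//= leq_addr.
split; first exact: measurable_box.
rewrite mB// ltey_eq; apply/orP; left.
apply: (big_ind (fun x => x \is a fin_num)) => // [x y|i _].
  exact: fin_numM.
by rewrite lebesgue_measure_itv/=; case: ifP.
Qed.

End lebesgue_box.

Lemma sigma_finite_of_measure (R : realType) d (T : measurableType d)
    (m : {measure set T -> \bar R}) : sigma_finite setT m ->
  exists ms : {sigma_finite_measure set T -> \bar R},
    (ms : set T -> \bar R) = m.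
Proof.
move=> sf.
pose H1 := isSFinite.Build _ _ _ (m : set T -> \bar R)
  (sfinite_measure_sigma_finite sf).
pose H2 := isSigmaFinite.Build _ _ _ (m : set T -> \bar R) sf.
pose ms : {sigma_finite_measure set T -> \bar R} :=
  HB.pack (Measure.sort m) (Measure.class m) H1 H2.
by exists ms.
Qed.

Section lebesgue_cons.
Context (R : realType) (n : nat).
Notation T := (measurableTypeR R).
Context (m : {sigma_finite_measure set (n.-tuple T) -> \bar R}).

Lemma lebesgue_cons_measure : exists mp : {measure set (n.+1.-tuple T) -> \bar R},
  (mp : set (n.+1.-tuple T) -> \bar R) =
  pushforward (@lebesgue_measure R \x m)%E (@cons_tuple R n).
Proof.
by exists (measure_function_pushforward__canonical__measure_function_Measure
  (@lebesgue_measure R \x m)%E (@measurable_cons_tuple R n)).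
Qed.

End lebesgue_cons.

Lemma lebesgue_tuple_spec (R : realType) (n : nat) :
  (exists ms : {sigma_finite_measure
       set (n.-tuple (measurableTypeR R)) -> \bar R},
     (ms : set _ -> \bar R) = @lebesgue_tuple R n) /\
  forall A : 'I_n -> set (measurableTypeR R), (forall i, measurable (A i)) ->
    (@lebesgue_tuple R n (box A) = \prod_(i < n) @lebesgue_measure R (A i))%E.
Proof.
elim: n => [|n [[m mE] mB]].
  have dB (A : 'I_0 -> set (measurableTypeR R)) :
      (\d_ ([tuple] : 0.-tuple (measurableTypeR R)) (box A) =
       \prod_(i < 0) @lebesgue_measure R (A i))%E.
    by rewrite big_ord0 diracE mem_set// => -[].
  split; last by move=> A _; exact: dB.
  apply: (sigma_finite_of_measure
    (m := \d_ ([tuple] : 0.-tuple (measurableTypeR R)))).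
  by apply: sigma_finite_box => A _; exact: dB.
have B (A : 'I_n.+1 -> set (measurableTypeR R)) :
    (forall i, measurable (A i)) ->
    (@lebesgue_tuple R n.+1 (box A) =
     \prod_(i < n.+1) @lebesgue_measure R (A i))%E.
  move=> mA; rewrite big_ord_recl /= -mE /pushforward.
  rewrite -mB; last by move=> i; exact: mA.
  have mbA : measurable (box (fun i => A (lift ord0 i))).
    by apply: measurable_box => i; exact: mA.
  rewrite -mE -(product_measure1E _ m (mA ord0) mbA).
  congr (product_measure1 _ _ _); apply/seteqP; split=> -[x t] /=.
    move=> Axt; split=> [|i]; first exact: (Axt ord0).
    by have := Axt (lift ord0 i); rewrite tnthS.
  move=> [Ax At] i; have [j ->|->] := unliftP ord0 i; last exact: Ax.
  by rewrite tnthS; exact: At.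
split=> //; have [mp mpE] := lebesgue_cons_measure m.
have pE : (mp : set _ -> \bar R) = @lebesgue_tuple R n.+1 by rewrite mpE mE.
rewrite -pE; apply: sigma_finite_of_measure; rewrite pE.
exact: sigma_finite_box.
Qed.

(* Main.v *)
Require Import Defs.
From mathcomp Require Import all_boot all_order all_algebra.
From mathcomp Require Import all_classical all_reals all_analysis.
From mathcomp Require Import measurable_realfun ring lra.
Import Order.TTheory GRing.Theory Num.Theory.
Import numFieldNormedType.Exports.
Local Open Scope classical_set_scope.
Local Open Scope ring_scope.
Set Implicit Arguments.
Unset Strict Implicit.
Unset Printing Implicit Defensive.

(** Let q be the quadratic form of the Gram matrix Xt^T Sigma^-1 Xt, h the
    estimate of theta, and a_i = nu_i s_i^2 + c, p_i = (n - r2 + nu_i) / 2.  The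
    Bayes factor can be written
      C2 (a0 + q h)^p0 / (a1 + q h)^p1 * E [((a1 + q h) / (a1 + q (x - h)))^p1],
    the expectation being over the prior x ~ N(0, Omega) ([B10E]).

    The expectation tends to 1 ([cvg_gaussian_expectation]): for fixed x the ratio
    tends to 1 as h goes to infinity ([qform_ratio_cvg]), and since
    q h <= 2 q (x - h) + 2 q x, it is at most 2 + 2 q x / a1 for every h.  A power
    of this bound is integrable against the Gaussian ([gaussian_majorant]), so
    dominated convergence applies.

    The prefactor behaves like C2 (q h)^((nu0 - nu1) / 2), where C2 is finite and
    positive because the values of Gamma are ([Gamma_gt0]).  Its limit is 0 or
    infinity according to the sign of nu0 - nu1; when nu0 = nu1 it is C2, in which
    all the Gamma factors cancel and (s1 / s0)^nu1 is left.

    The total mass of the multivariate normal density is obtained by induction on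
    the dimension, by completing the square in one coordinate and passing to the
    Schur complement ([integral_gauss_Rn]).  Positive definite forms are compared
    with each other through the Cauchy-Schwarz inequality ([qform_le_posdef]). *)

(** * Quadratic forms *)

Section quadratic_forms.
Context (R : realType).

Lemma qformZ n (A : 'M[R]_n) (k : R) (x : 'cV[R]_n) :
  qform A (k *: x) = k ^+ 2 * qform A x.
Proof.
by rewrite /qform [(_ *: _)^T]linearZ/= -!scalemxAl -scalemxAr scalerA mxE.
Qed.

Lemma qformN n (A : 'M[R]_n) (x : 'cV[R]_n) : qform A (- x) = qform A x.
Proof. by rewrite -scaleN1r qformZ sqrrN expr1n mul1r. Qed.

Lemma qformE n (A : 'M[R]_n) (x : 'cV[R]_n) :
  qform A x = \sum_i \sum_j x i 0 * A i j * x j 0.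
Proof.
rewrite /qform -mulmxA mxE; apply: eq_bigr => i _; rewrite !mxE mulr_sumr.
by apply: eq_bigr => j _; rewrite mulrA.
Qed.

(** Splitting u into its A-projection t v and the A-orthogonal rest, only the
    nonnegative term q(u - t v) is lost. *)
Lemma posdef_cauchy_schwarz n (A : 'M[R]_n) (u v : 'cV[R]_n) : posdef A ->
  (u^T *m A *m v) 0 0 ^+ 2 <= qform A u * qform A v.
Proof.
move=> Apd; have [->|v0] := eqVneq v 0.
  by rewrite /qform !mulmx0 mxE expr0n/= mulr0.
have qv := Apd.2 _ v0; set b := (u^T *m A *m v) 0 0.
pose t := b / qform A v.
have -> : qform A u = qform A (u - t *: v) + qform A (t *: v).
  rewrite -qformD ?subrK//; first exact: Apd.1.
  apply/matrixP => i j; rewrite !ord1 [RHS]mxE.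
  rewrite [(_ *: _)^T]linearZ/= -!scalemxAl mxE mulmxBr -scalemxAr.
  have -> : v^T *m A *m u = (u^T *m A *m v)^T.
    by rewrite !trmx_mul trmxK Apd.1 mulmxA.
  have subE (P Q : 'M[R]_1) : (P - t *: Q) 0 0 = P 0 0 - t * Q 0 0.
    by rewrite !mxE.
  by rewrite subE mxE -/b -/(qform A v) /t divfK ?gt_eqF// subrr mulr0.
rewrite mulrDl ler_wpDl//; first by rewrite mulr_ge0 ?posdef_qform_ge0.
by rewrite qformZ /t -mulrA -expr2 -exprMn divfK// gt_eqF.
Qed.

(** The i-th coordinate of x is the A-inner product of A^-1 e_i with x, so the
    Cauchy-Schwarz inequality bounds it without any spectral theory. *)
Lemma posdef_sumsq_le n (A : 'M[R]_n) (x : 'cV[R]_n) : posdef A ->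
  \sum_(i < n) x i 0 ^+ 2 <= \tr (invmx A) * qform A x.
Proof.
move=> Apd; have uA := posdef_unitmx Apd.
rewrite /mxtrace mulr_suml; apply: ler_sum => i _.
have := posdef_cauchy_schwarz (invmx A *m delta_mx i 0) x Apd.
rewrite trmx_mul trmx_inv Apd.1 -!mulmxA mulKmx// trmx_delta -rowE mxE.
suff -> : qform A (invmx A *m delta_mx i 0) = invmx A i i by [].
rewrite /qform trmx_mul trmx_inv Apd.1 -!mulmxA mulKVmx// trmx_delta.
by rewrite -rowE -colE !mxE.
Qed.

Lemma qform_le_sumsq n (A : 'M[R]_n) (x : 'cV[R]_n) :
  qform A x <= (\sum_i \sum_j `|A i j|) * \sum_(i < n) x i 0 ^+ 2.
Proof.
rewrite qformE mulr_suml; apply: ler_sum => i _.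
rewrite mulr_suml; apply: ler_sum => j _.
apply: (le_trans (ler_norm _)); rewrite !normrM.
have xS k : x k 0 ^+ 2 <= \sum_(i < n) x i 0 ^+ 2.
  by rewrite (bigD1 k)//= lerDl sumr_ge0// => l _; exact: sqr_ge0.
have -> : `|x i 0| * `|A i j| * `|x j 0| = `|A i j| * (`|x i 0| * `|x j 0|).
  by ring.
apply: ler_wpM2l => //; have := xS i; have := xS j.
rewrite -(real_normK (num_real (x i 0))) -(real_normK (num_real (x j 0))).
have := sqr_ge0 (`|x i 0| - `|x j 0|); rewrite sqrrB.
lra.
Qed.

(** Compares the Gram matrix of the design with the prior precision, so that the
    Gaussian exponent of the prior can absorb powers of the former. *)
Lemma qform_le_posdef n (A B : 'M[R]_n) : posdef B ->
  exists2 K : R, 0 <= K & forall x : 'cV[R]_n, qform A x <= K * qform B x.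
Proof.
move=> Bpd; pose K1 := \sum_i \sum_j `|A i j|.
have K1_ge0 : 0 <= K1 by apply: sumr_ge0 => i _; exact: sumr_ge0.
pose K := K1 * \tr (invmx B).
exists `|K| => // x; apply: (@le_trans _ _ (K * qform B x)).
  apply: (le_trans (qform_le_sumsq _ _)).
  by rewrite /K -mulrA ler_wpM2l// posdef_sumsq_le.
by rewrite ler_wpM2r ?posdef_qform_ge0// ler_norm.
Qed.

(** The defect of the inequality is d q(u - v / d).  The case d = 1 gives the
    global domination below, and d -> 0 the pointwise limit. *)
Lemma qform_young n (A : 'M[R]_n) (d : R) (u v : 'cV[R]_n) :
  posdef A -> 0 < d ->
  qform A (u + v) <= (1 + d) * qform A u + (1 + d^-1) * qform A v.
Proof.
move=> Apd d0.
have <- : qform A (u + v) + d * qform A (u - d^-1 *: v) =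
    (1 + d) * qform A u + (1 + d^-1) * qform A v.
  rewrite !qformE !mulr_sumr -!big_split/=; apply: eq_bigr => i _.
  rewrite !mulr_sumr -!big_split/=; apply: eq_bigr => j _.
  by rewrite !mxE; field; rewrite gt_eqF.
by rewrite lerDl mulr_ge0 ?posdef_qform_ge0// ltW.
Qed.

(** The bound is uniform in u apart from the last term, which is at most a
    multiple of q(v) / a, and vanishes when q(u) tends to infinity. *)
Lemma qform_ratio_le n (A : 'M[R]_n) (a d : R) (u v : 'cV[R]_n) :
  posdef A -> 0 < a -> 0 < d ->
  (a + qform A (u + v)) / (a + qform A u) <=
  1 + d + (1 + d^-1) * qform A v / (a + qform A u).
Proof.
move=> Apd a0 d0; have Z0 : 0 < a + qform A u.
  by rewrite ltr_wpDr ?posdef_qform_ge0.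
rewrite ler_pdivrMr// mulrDl divfK ?gt_eqF//.
have := qform_young u v Apd d0; have : 0 <= d * a by rewrite mulr_ge0// ltW.
by lra.
Qed.

Lemma qform_scale n (k : R) (A : 'M[R]_n) (x : 'cV[R]_n) :
  qform (k *: A) x = k * qform A x.
Proof. by rewrite /qform -scalemxAr -scalemxAl mxE. Qed.

Lemma posdefZ n (k : R) (A : 'M[R]_n) : 0 < k -> posdef A -> posdef (k *: A).
Proof.
move=> k0 [As Apos]; split=> [|x x0]; first by rewrite linearZ/= As.
by rewrite qform_scale mulr_gt0// Apos.
Qed.

End quadratic_forms.

(** * Powers against exponentials, and the Gamma function *)

Section gamma_function.
Context (R : realType).
Notation mu := (@lebesgue_measure R).

(** From v = (p / e) (e v / p) and 1 + x <= exp x.  It makes every power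
    negligible against the tail of an exponential or a Gaussian. *)
Lemma powR_le_expR (p e : R) : 0 <= p -> 0 < e ->
  exists2 C : R, 0 < C & forall v, 0 <= v -> v `^ p <= C * expR (e * v).
Proof.
move=> p0 e0; have [->|pN0] := eqVneq p 0.
  exists 1 => // v v0; rewrite powRr0 mul1r -[leLHS]expR0 ler_expR.
  by rewrite mulr_ge0// ltW.
have pgt0 : 0 < p by rewrite lt_def pN0.
exists ((p / e) `^ p); first by rewrite powR_gt0// divr_gt0.
move=> v v0; have -> : e * v = (e * v / p) * p by rewrite divfK.
have pe0 : 0 <= p / e by rewrite divr_ge0// ltW.
rewrite expRM -powRM ?expR_ge0//.
apply: ge0_ler_powR => //; rewrite ?nnegrE ?(mulr_ge0 pe0) ?expR_ge0//.
have {1}-> : v = p / e * (e * v / p) by field; rewrite pN0 gt_eqF.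
rewrite ler_pM2l ?divr_gt0//; apply: le_trans (expR_ge1Dx _).
by rewrite lerDr.
Qed.

Definition gamma_integrand (x t : R) : R := t `^ (x - 1) * expR (- t).

Lemma gamma_integrand_ge0 x t : 0 <= gamma_integrand x t.
Proof. by rewrite mulr_ge0 ?powR_ge0 ?expR_ge0. Qed.

Lemma measurable_gamma_integrand x (D : set R) :
  measurable_fun D (EFin \o gamma_integrand x).
Proof.
apply/measurable_EFinP/measurable_funTS/measurable_funM.
  exact: measurable_powR.
by apply: measurableT_comp => //; exact: measurableT_comp.
Qed.

Lemma itv_oc01_bigcup :
  `]0, 1]%classic = \bigcup_i `[(i.+2%:R)^-1, 1]%classic :> set R.
Proof.
apply/seteqP; split=> t /=.
  rewrite in_itv/= => /andP[t0 t1]; exists (Num.truncn t^-1) => //=.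
  rewrite in_itv/= t1 andbT invf_ple ?posrE//.
  by rewrite (le_trans (ltW (truncnS_gt _)))// ler_nat.
move=> [i _] /=; rewrite !in_itv/= => /andP[it ->]; rewrite andbT.
by apply: lt_le_trans it; rewrite invr_gt0.
Qed.

(** On [a, 1] the integrand is continuous, whatever the sign of x - 1; the
    singularity at 0 is reached only through a monotone limit. *)
Lemma integral_powR_segment (x a : R) : 0 < x -> 0 < a < 1 ->
  (\int[mu]_(t in `[a, 1%R]) (t `^ (x - 1))%:E = (x^-1 - a `^ x / x)%:E)%E.
Proof.
move=> x0 /andP[a0 a1].
have pos (y : R) : y \in `[a, 1] -> 0 < y.
  by rewrite in_itv/= => /andP[ay _]; exact: lt_le_trans ay.
have dF (y : R) : 0 < y -> is_derive y 1 (fun t => x^-1 * t `^ x) (y `^ (x - 1)).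
  move=> y0; have -> : y `^ (x - 1) = x^-1 *: (x * y `^ (x - 1)).
    by rewrite /GRing.scale/= mulKf// gt_eqF.
  exact: (@is_deriveZ _ _ _ (fun t => t `^ x) x^-1 y 1 _ (is_derive1_powR x y0)).
have cF (y : R) : 0 < y -> {for y, continuous (fun t : R => x^-1 * t `^ x)}.
  move=> y0; apply: differentiable_continuous; apply/derivable1_diffP.
  by have [] := dF _ y0.
rewrite (@continuous_FTC2 _ _ (fun t => x^-1 * t `^ x))//.
- by rewrite -EFinB powR1 mulr1 [_ * a `^ x]mulrC.
- apply: derivable_within_continuous => y /pos y0.
  by apply: derivable_powR; rewrite in_itv/= y0.
- split.
  + by move=> y /subset_itv_oo_cc/pos/dF[].
  + by apply: cvg_at_right_filter; exact: cF.
  + by apply: cvg_at_left_filter; exact: cF.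
- move=> y /subset_itv_oo_cc/pos/dF dy.
  by rewrite derive1E; exact: derive_val.
Qed.

Lemma integral_powR_oc01_lty (x : R) : 0 < x ->
  (\int[mu]_(t in `]0%R, 1%R]) (t `^ (x - 1))%:E < +oo)%E.
Proof.
move=> x0.
have mf (D : set R) : measurable_fun D (EFin \o (fun t => t `^ (x - 1))).
  apply/measurable_EFinP; apply: measurable_funTS; exact: measurable_powR.
apply: (@le_lt_trans _ _ (x^-1)%:E); last exact: ltry.
pose S (i : nat) : set R := `[(i.+2%:R)^-1, 1]%classic.
have ndS : nondecreasing_seq S.
  move=> i j ij; apply/subsetPset => t; rewrite /S/= !in_itv/= => /andP[it ->].
  by rewrite andbT (le_trans _ it)// lef_pV2 ?posrE// ler_nat.
have -> : `]0, 1]%classic = \bigcup_i S i by exact: itv_oc01_bigcup.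
have mS i : measurable (S i) by exact: measurable_itv.
have f0 i t : S i t -> (0 <= (t `^ (x - 1))%:E)%E.
  by move=> _; rewrite lee_fin powR_ge0.
have mfS i := mf (S i).
have /cvg_lim <- // := @ge0_nondecreasing_set_cvg_integral _ _ _ _ _ mu ndS mS mfS f0.
apply: lime_le.
  apply: ereal_nondecreasing_is_cvgn.
  exact: (@ge0_nondecreasing_set_nondecreasing_integral _ _ _ _ _ mu ndS mS mfS f0).
apply: nearW => i; rewrite integral_powR_segment//.
  by rewrite lee_fin lerBlDr lerDl divr_ge0 ?powR_ge0 ?(ltW x0).
by rewrite invr_gt0 ltr0n/= invf_lt1 ?ltr1n ?ltr0n.
Qed.

(** Near 0 the exponential factor is at most 1; away from 0 the power is at most
    C exp(t / 2), which leaves a multiple of the exponential density of rate 1/2. *)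
Lemma gamma_integral_lty (x : R) : 0 < x ->
  (\int[mu]_(t in `]0%R, +oo[) (gamma_integrand x t)%:E < +oo)%E.
Proof.
move=> x0.
have -> : `]0, +oo[%classic = `]0, 1]%classic `|` `]1, +oo[%classic :> set R.
  by apply: itv_bndbnd_setU; rewrite bnd_simp.
have mg := measurable_gamma_integrand x.
have g0 t : (0 <= (gamma_integrand x t)%:E)%E.
  by rewrite lee_fin gamma_integrand_ge0.
rewrite ge0_integral_setU//; [|exact: mg|]; last first.
  apply/disj_set2P/seteqP; split=> // t [] /=; rewrite !in_itv/= andbT.
  by move=> /andP[_ t1] /(le_lt_trans t1); rewrite ltxx.
apply: lte_add_pinfty.
  apply: le_lt_trans (integral_powR_oc01_lty x0).
  apply: ge0_le_integral => //; first exact: mg.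
    apply/measurable_EFinP; apply: measurable_funTS; exact: measurable_powR.
  move=> t /=; rewrite in_itv/= lee_fin => /andP[t0 _].
  by rewrite /gamma_integrand ler_piMr ?powR_ge0// -expR0 ler_expR oppr_le0 ltW.
have [C C0 HC] := @powR_le_expR `|x - 1| 2^-1 (normr_ge0 _) ltac:(by []).
pose h (t : R) := (C * 2) * exponential_pdf 2^-1 t.
have h0 t : 0 <= h t.
  by rewrite mulr_ge0 ?exponential_pdf_ge0 ?mulr_ge0// ltW.
have mh : measurable_fun [set: R] (EFin \o h).
  apply/measurable_EFinP/measurable_funM => //.
  exact: measurable_exponential_pdf.
apply: (@le_lt_trans _ _ (\int[mu]_t (h t)%:E)%E).
  apply: (@le_trans _ _ (\int[mu]_(t in `]1%R, +oo[) (h t)%:E)%E); last first.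
    by apply: ge0_subset_integral => // t _; rewrite lee_fin.
  apply: ge0_le_integral => //; first exact: mg.
    exact: measurable_funTS.
  move=> t /=; rewrite in_itv/= andbT lee_fin => t1.
  have t0 : 0 < t by exact: lt_trans t1.
  rewrite /h /exponential_pdf patchE ifT; last first.
    by rewrite inE/= in_itv/= andbT ltW.
  have -> : C * 2 * (2^-1 * expR (- 2^-1 * t)) = C * expR (2^-1 * t) * expR (- t).
    rewrite -[RHS]mulrA -expRD mulrA -[C * 2 / 2]mulrA mulfV// mulr1.
    by congr (_ * expR _); lra.
  rewrite ler_wpM2r ?expR_ge0//; apply: le_trans (HC _ (ltW t0)).
  by apply: ler_powR; [exact: ltW|exact: ler_norm].
under eq_integral do rewrite EFinM.
rewrite ge0_integralZl_EFin//.
- by rewrite integral_exponential_pdf// mule1 ltry.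
- by move=> t _; rewrite lee_fin exponential_pdf_ge0.
- by apply/measurable_EFinP; exact: measurable_exponential_pdf.
- by rewrite mulr_ge0// ltW.
Qed.

(** It suffices to bound the integrand below by a positive constant on [1, 2],
    where 0 <= ln t <= t. *)
Lemma gamma_integral_gt0 (x : R) :
  (0 < \int[mu]_(t in `]0%R, +oo[) (gamma_integrand x t)%:E)%E.
Proof.
pose k := expR (- ((`|x - 1| + 1) * 2)).
apply: (@lt_le_trans _ _ (\int[mu]_(t in `[1%R, 2%R]) (gamma_integrand x t)%:E)%E).
  apply: (@lt_le_trans _ _ (\int[mu]_(t in `[1%R, 2%R]) k%:E)%E).
    rewrite integral_cst//= lebesgue_measure_itv/= lte_fin ltr1n.
    by rewrite -EFinB -EFinM lte_fin mulr_gt0 ?expR_gt0// subr_gt0 ltr1n.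
  apply: ge0_le_integral => //.
  - by move=> t _; rewrite lee_fin expR_ge0.
  - exact: measurable_gamma_integrand.
  move=> t /=; rewrite in_itv/= lee_fin => /andP[t1 t2].
  have t0 : 0 < t by exact: lt_le_trans t1.
  rewrite /gamma_integrand /powR gt_eqF// -expRD ler_expR.
  have lt : 0 <= ln t <= t.
    rewrite ln_ge0//= -ler_expR lnK ?posrE//.
    by apply: le_trans (expR_ge1Dx t); rewrite lerDr.
  have h1 : - (`|x - 1| * t) <= (x - 1) * ln t.
    apply: (@le_trans _ _ (- (`|x - 1| * ln t))).
      by rewrite lerN2 ler_wpM2l ?(andP lt).2.
    by rewrite -mulNr ler_wpM2r ?(andP lt).1// lerNl -normrN ler_norm.
  have h2 : `|x - 1| * t <= `|x - 1| * 2 by rewrite ler_wpM2l.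
  by apply: le_trans (lerD h1 (lexx _)); lra.
apply: ge0_subset_integral => //.
- exact: measurable_gamma_integrand.
- by move=> t _; rewrite lee_fin gamma_integrand_ge0.
- move=> t /=; rewrite !in_itv/= andbT => /andP[t1 _].
  exact: lt_le_trans t1.
Qed.

(** [Rintegral] sends a divergent integral to 0, so that finiteness of the
    integral matters here as much as its positivity. *)
Lemma Gamma_gt0 (x : R) : 0 < x -> 0 < Gamma x.
Proof.
move=> x0; apply: fine_gt0; apply/andP; split.
  exact: gamma_integral_gt0.
exact: gamma_integral_lty.
Qed.

End gamma_function.

(** * Limits of ratios and of quotients of powers *)

Section ratio_limits.
Context (R : realType).

(** The ratio r satisfies r <= 1 + d + o(1), and exchanging the two points in
    the same inequality gives 1 <= (1 + d) r + o(1), for every d > 0. *)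
Lemma qform_ratio_cvg n (A : 'M[R]_n) (a : R) (h : nat -> 'cV[R]_n)
    (t : 'cV[R]_n) : posdef A -> 0 < a ->
  qform A (h k) @[k --> \oo] --> +oo ->
  (a + qform A (h k)) / (a + qform A (t - h k)) @[k --> \oo] --> (1 : R).
Proof.
move=> Apd a0 /cvgryPge hoo; apply/cvgrPdist_le => /= e e0.
pose d := e / 2; have d0 : 0 < d by rewrite divr_gt0.
(* q(h) >= B makes q(h - t) so large that the o(1) term is at most d *)
pose B := 2 * ((1 + d^-1) * qform A t / d + qform A t).
near=> k.
have Bk : B <= qform A (h k) by near: k; exact: hoo.
set z := h k - t.
have -> : qform A (t - h k) = qform A z by rewrite -opprB qformN.
have hz : h k = z + t by rewrite subrK.
have q0 x : 0 <= qform A x by exact: posdef_qform_ge0.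
have Z0 : 0 < a + qform A z by rewrite ltr_wpDr.
have H0 : 0 < a + qform A (h k) by rewrite ltr_wpDr.
have Zbig : (1 + d^-1) * qform A t / (a + qform A z) <= d.
  rewrite ler_pdivrMr// [d * _]mulrC -ler_pdivrMr//.
  have := @qform_young _ _ A 1 z t Apd ltac:(by []).
  rewrite -hz invr1 => ?; move: Bk; rewrite /B.
  lra.
have := qform_ratio_le z t Apd a0 d0; rewrite -hz => up.
have lo : a + qform A z <= (1 + d) * (a + qform A (h k)) + (1 + d^-1) * qform A t.
  have := @qform_young _ _ A d (h k) (- t) Apd d0; rewrite qformN -/z.
  have : 0 <= d * a by rewrite mulr_ge0// ltW.
  lra.
have {}lo : 1 <= (1 + d) * ((a + qform A (h k)) / (a + qform A z)) + d.
  have : 1 <= ((1 + d) * (a + qform A (h k)) + (1 + d^-1) * qform A t)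
       / (a + qform A z) by rewrite ler_pdivlMr// mul1r.
  by rewrite mulrDl -mulrA; lra.
set r := (a + qform A (h k)) / (a + qform A z) in up lo *.
have r0 : 0 < r by exact: divr_gt0.
have ed : e = 2 * d by rewrite /d mulrC divfK.
rewrite distrC ler_norml; apply/andP; split; last by lra.
rewrite leNgt; apply/negP => r1.
have : d * r <= d * 1 by rewrite ler_wpM2l ?(ltW d0)//; lra.
by lra.
Unshelve. all: by end_near. Qed.

Lemma cvg_powR1 (r : nat -> R) (p : R) : r k @[k --> \oo] --> (1 : R) ->
  r k `^ p @[k --> \oo] --> (1 : R).
Proof.
move=> r1; have c1 : {for 1, continuous (fun x : R => x `^ p)}.
  apply: differentiable_continuous; apply/derivable1_diffP.
  by apply: derivable_powR; rewrite in_itv/= ltr01.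
have := cvg_comp r (fun x => x `^ p) r1 c1.
by rewrite powR1.
Qed.

Lemma cvgy_powR (x : nat -> R) (s : R) : 0 < s -> x k @[k --> \oo] --> +oo ->
  x k `^ s @[k --> \oo] --> +oo.
Proof.
move=> s0 /cvgryPge xoo; apply/cvgryPge => A; near=> k.
have Ak : `|A| `^ s^-1 <= x k by near: k; exact: xoo.
apply: le_trans (ler_norm A) _.
rewrite -[leLHS]powRr1// -[1](mulVf (lt0r_neq0 s0)) powRrM.
apply: ge0_ler_powR; rewrite ?nnegrE ?powR_ge0 ?(ltW s0)//.
exact: le_trans (powR_ge0 _ _) Ak.
Unshelve. all: by end_near. Qed.

Lemma powR_div (x y p : R) : 0 <= x -> 0 < y ->
  (x / y) `^ p = x `^ p * y `^ (- p).
Proof.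
move=> x0 y0; rewrite powRM ?invr_ge0 ?(ltW y0)//; congr (_ * _).
by rewrite -(powR_inv1 (ltW y0)) -powRrM mulN1r.
Qed.

(** The quotient (a0 + x)^p0 / (a1 + x)^p1 is asymptotic to x^(p0 - p1): this is
    where the comparison of the degrees of freedom decides the limit. *)
Section power_quotient.
Variables (a0 a1 : R) (x : nat -> R).
Hypothesis xoo : x k @[k --> \oo] --> +oo.

Let shift_oo (a : R) : a + x k @[k --> \oo] --> +oo.
Proof.
apply/cvgryPge => A; near=> k; rewrite -lerBlDl; near: k.
by move/cvgryPge: xoo; apply.
Unshelve. all: by end_near. Qed.

Let shift_gt0 (a : R) : \forall k \near \oo, 0 < a + x k.
Proof. by move/cvgryPgt : (shift_oo a); apply. Qed.

Lemma cvg_shift_ratio : (a0 + x k) / (a1 + x k) @[k --> \oo] --> (1 : R).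
Proof.
have inv0 : (a1 + x k)^-1 @[k --> \oo] --> (0 : R).
  by apply/(gtr0_cvgV0 (shift_gt0 a1)); exact: shift_oo.
have : 1 + (a0 - a1) * (a1 + x k)^-1 @[k --> \oo] --> (1 + (a0 - a1) * 0 : R).
  by apply: cvgD; [exact: cvg_cst|apply: cvgM; [exact: cvg_cst|]].
rewrite mulr0 addr0; apply: cvg_trans; apply: near_eq_cvg.
near=> k; have k0 : 0 < a1 + x k by near: k; exact: shift_gt0.
by field; rewrite gt_eqF.
Unshelve. all: by end_near. Qed.

Let quotientE (p0 p1 : R) : \forall k \near \oo,
  (a0 + x k) `^ p0 / (a1 + x k) `^ p1 =
  ((a0 + x k) / (a1 + x k)) `^ p0 * (a1 + x k) `^ (p0 - p1).
Proof.
near=> k.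
have k0 : 0 < a0 + x k by near: k; exact: shift_gt0.
have k1 : 0 < a1 + x k by near: k; exact: shift_gt0.
rewrite powR_div// ?(ltW k0)// -mulrA -powRD ?(gt_eqF k1) ?implybT//.
by rewrite addrA addNr add0r powRN.
Unshelve. all: by end_near. Qed.

Lemma cvg_quotient0 (p0 p1 : R) : p0 < p1 ->
  (a0 + x k) `^ p0 / (a1 + x k) `^ p1 @[k --> \oo] --> (0 : R).
Proof.
move=> p01.
have ratio := @cvg_powR1 _ p0 cvg_shift_ratio.
have inv0 : (a1 + x k) `^ (p0 - p1) @[k --> \oo] --> (0 : R).
  have -> : (fun k => (a1 + x k) `^ (p0 - p1)) =
      (fun k => ((a1 + x k) `^ (p1 - p0))^-1).
    by apply/funext => k; rewrite -powRN opprB.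
  apply/gtr0_cvgV0; last first.
    by apply: cvgy_powR; [rewrite subr_gt0|exact: shift_oo].
  by near=> k; apply: powR_gt0; near: k; exact: shift_gt0.
have : ((a0 + x k) / (a1 + x k)) `^ p0 * (a1 + x k) `^ (p0 - p1)
    @[k --> \oo] --> (1 * 0 : R) by exact: cvgM.
rewrite mul1r; apply: cvg_trans.
by apply: near_eq_cvg; near=> k; rewrite (near (quotientE p0 p1) k).
Unshelve. all: by end_near. Qed.

Lemma cvg_quotient1 (p : R) :
  (a0 + x k) `^ p / (a1 + x k) `^ p @[k --> \oo] --> (1 : R).
Proof.
have := @cvg_powR1 _ p cvg_shift_ratio; apply: cvg_trans.
apply: near_eq_cvg; near=> k; rewrite (near (quotientE p p) k)//.
by rewrite subrr powRr0 mulr1.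
Unshelve. all: by end_near. Qed.

Lemma cvg_quotienty (p0 p1 : R) : p1 < p0 ->
  (a0 + x k) `^ p0 / (a1 + x k) `^ p1 @[k --> \oo] --> +oo.
Proof.
move=> p01.
have ratio := @cvg_powR1 _ p0 cvg_shift_ratio.
have big : (a1 + x k) `^ (p0 - p1) @[k --> \oo] --> +oo.
  by apply: cvgy_powR; [rewrite subr_gt0|exact: shift_oo].
apply/cvgryPge => A; near=> k.
rewrite (near (quotientE p0 p1) k)//.
have rk : 2^-1 <= ((a0 + x k) / (a1 + x k)) `^ p0.
  near: k; apply: (cvgr_ge 1 ratio); lra.
have bk : 2 * `|A| <= (a1 + x k) `^ (p0 - p1).
  by near: k; move/cvgryPge: big; apply.
apply: le_trans (ler_norm A) _; rewrite -[leLHS](mulKf (x := 2))//.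
exact: ler_pM.
Unshelve. all: by end_near. Qed.

End power_quotient.
End ratio_limits.

(** * Gaussian integrals in several variables *)

Section gaussian_integral.
Context (R : realType).

Definition schur n (A : 'M[R]_(1 + n)) : 'M[R]_n :=
  drsubmx A - (A 0 0)^-1 *: (dlsubmx A *m (dlsubmx A)^T).

Lemma symmetric_block n (A : 'M[R]_(1 + n)) : A^T = A ->
  A = block_mx (A 0 0)%:M (dlsubmx A)^T (dlsubmx A) (drsubmx A).
Proof.
move=> As; rewrite -{1}(submxK A) trmx_dlsub As; congr block_mx.
by apply/matrixP => i j; rewrite !ord1 !mxE/=; congr (A _ _); apply/val_inj.
Qed.

(** Completing the square in the first coordinate. *)
Lemma qform_schur n (A : 'M[R]_(1 + n)) (x : R) (t : 'cV[R]_n) :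
  A^T = A -> A 0 0 != 0 ->
  qform A (col_mx x%:M t) =
    A 0 0 * (x + (A 0 0)^-1 * ((dlsubmx A)^T *m t) 0 0) ^+ 2
    + qform (schur A) t.
Proof.
move=> As a0; rewrite /qform {1}(symmetric_block As) /schur.
set a := A 0 0; set b := dlsubmx A; set D := drsubmx A.
rewrite tr_col_mx mul_row_block mul_row_col tr_scalar_mx.
rewrite !mul_scalar_mx mulmxBr mulmxBl mulmxDl -scalemxAr -!scalemxAl.
rewrite !mulmxDl -!scalemxAl !mul_mx_scalar.
have -> : t^T *m (b *m b^T) *m t = (b^T *m t)^T *m (b^T *m t).
  by rewrite trmx_mul trmxK !mulmxA.
have -> : t^T *m b = (b^T *m t)^T by rewrite trmx_mul trmxK.
set u := b^T *m t.
have uE : (u^T *m u) 0 0 = u 0 0 ^+ 2 by rewrite mxE big_ord1 mxE.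
move: uE; set w := u^T *m u; set v := t^T *m D *m t => wE.
(* w, v and u are made opaque, so that mxE stops at their entries *)
clearbody w v; clearbody u; rewrite !mxE wE eqxx /= !mulr1n.
by field.
Qed.

(** A is the product of a block lower triangular matrix with unit diagonal and a
    block upper triangular one with diagonal blocks A 0 0 and the complement. *)
Lemma det_schur n (A : 'M[R]_(1 + n)) : A^T = A -> A 0 0 != 0 ->
  \det A = A 0 0 * \det (schur A).
Proof.
move=> As a0; rewrite {1}(symmetric_block As).
set a := A 0 0; set b := dlsubmx A; set D := drsubmx A.
have -> : block_mx a%:M b^T b D =
    block_mx 1%:M 0 (a^-1 *: b) 1%:M *m block_mx a%:M b^T 0 (schur A).
  rewrite mulmx_block !mul1mx !mul0mx !addr0.
  congr block_mx.
    by rewrite mul_mx_scalar scalerA mulfV// scale1r.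
  by rewrite /schur -scalemxAl -/a -/b -/D addrC subrK.
by rewrite det_mulmx det_lblock det_ublock !det1 !mul1r det_scalar1.
Qed.

Lemma posdef_corner n (A : 'M[R]_(1 + n)) : posdef A -> 0 < A 0 0.
Proof.
move=> [_ Apos]; have := Apos (delta_mx 0 0).
have -> : qform A (delta_mx 0 0) = A 0 0.
  by rewrite /qform trmx_delta -rowE -colE !mxE.
apply; apply/eqP => /matrixP/(_ 0 0)/eqP.
by rewrite !mxE !eqxx oner_eq0.
Qed.

Lemma posdef_schur n (A : 'M[R]_(1 + n)) : posdef A -> posdef (schur A).
Proof.
move=> Apd; have a0 := posdef_corner Apd; have [As Apos] := Apd.
split.
  rewrite /schur [LHS]linearB/= [(_ *: _)^T]linearZ/= trmx_mul trmxK.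
  by rewrite trmx_drsub As.
move=> t t0; pose x := - ((A 0 0)^-1 * ((dlsubmx A)^T *m t) 0 0).
have /Apos : col_mx x%:M t != 0 :> 'cV[R]_(1 + n).
  by apply: contra_neq t0 => /eqP; rewrite col_mx_eq0 => /andP[_ /eqP].
by rewrite qform_schur// ?gt_eqF// /x addNr expr0n/= mulr0 add0r.
Qed.

Lemma integral_gauss (a m : R) : 0 < a ->
  (\int[@lebesgue_measure R]_x (expR (- (a * (x + m) ^+ 2 / 2)))%:E =
   (Num.sqrt (2 * pi / a))%:E)%E.
Proof.
move=> a0; pose s := Num.sqrt a^-1.
have s2 : s ^+ 2 = a^-1 by rewrite sqr_sqrtr// invr_ge0 ltW.
have s0 : s != 0 by rewrite gt_eqF// sqrtr_gt0 invr_gt0.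
have P0 : 0 < Num.sqrt (2 * pi / a).
  by rewrite sqrtr_gt0 divr_gt0 ?mulr_gt0 ?pi_gt0.
have fE x : expR (- (a * (x + m) ^+ 2 / 2)) =
    Num.sqrt (2 * pi / a) * normal_pdf (- m) s x.
  rewrite normal_pdfE// /normal_peak /normal_fun s2 opprK.
  have -> : a^-1 * pi *+ 2 = 2 * pi / a by rewrite -mulr_natl; ring.
  rewrite mulVKf ?gt_eqF//; congr expR.
  by rewrite -mulr_natl; field; rewrite gt_eqF.
under eq_integral do rewrite fE EFinM.
rewrite ge0_integralZl_EFin//.
- by rewrite integral_normal_pdf mule1.
- by move=> x _; rewrite lee_fin normal_pdf_ge0.
- by apply/measurable_EFinP; exact: measurable_normal_pdf.
Qed.

Lemma col_of_cons_tuple n (x : R) (t : n.-tuple (measurableTypeR R)) :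
  col_of_tuple (Defs.cons_tuple (x, t)) = col_mx x%:M (col_of_tuple t) :> 'cV[R]_(1 + n).
Proof.
apply/matrixP => i j; rewrite ord1 mxE; case: (split_ordP i) => k ->.
  by rewrite col_mxEu !ord1 mxE /= mulr1n /Defs.cons_tuple (tnth_nth 0).
rewrite col_mxEd mxE.
have -> : rshift 1 k = lift ord0 k by apply: val_inj.
by rewrite tnthS.
Qed.

(** Tonelli, in the order that integrates the first coordinate innermost: this
    is the one in which the square can be completed. *)
Lemma integral_Rn_recl n (f : 'cV[R]_(1 + n) -> \bar R) :
  (forall x, (0 <= f x)%E) ->
  measurable_fun setT (fun t : n.+1.-tuple (measurableTypeR R) => f (col_of_tuple t)) ->
  integral_Rn f = integral_Rn (fun t : 'cV[R]_n =>
    (\int[@lebesgue_measure R]_x f (col_mx x%:M t))%E).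
Proof.
move=> f0 mf; rewrite /integral_Rn.
have [[m mE] _] := lebesgue_tuple_spec R n; rewrite /= -mE.
rewrite (ge0_integral_pushforward (@measurable_cons_tuple R n))//.
rewrite preimage_setT fubini_tonelli2//=; last first.
  exact: measurableT_comp mf (@measurable_cons_tuple R n).
apply: eq_integral => t _; apply: eq_integral => x _.
by rewrite /= col_of_cons_tuple.
Qed.

Lemma measurable_qform n (A : 'M[R]_n) (h : 'cV[R]_n) :
  measurable_fun setT (fun t : n.-tuple (measurableTypeR R) =>
    qform A (col_of_tuple t - h)).
Proof.
under eq_fun do rewrite qformE.
apply: measurable_sum => i; apply: measurable_sum => j.
apply: measurable_funM; first apply: measurable_funM => //.
- under eq_fun do rewrite !mxE.
  by apply: measurable_funB => //; exact: measurable_tnth.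
- under eq_fun do rewrite !mxE.
  by apply: measurable_funB => //; exact: measurable_tnth.
Qed.

Lemma measurable_gauss n (A : 'M[R]_n) :
  measurable_fun setT (fun t : n.-tuple (measurableTypeR R) =>
    (expR (- (qform A (col_of_tuple t) / 2)))%:E).
Proof.
apply/measurable_EFinP; apply: measurableT_comp => //.
apply: measurableT_comp => //; apply: measurable_funM => //.
have := measurable_qform A 0; apply: eq_measurable_fun => t _.
by rewrite subr0.
Qed.

(** By induction on the dimension: the innermost integral over the first
    coordinate is a translated one-dimensional Gaussian integral, and what
    remains is the Gaussian of the Schur complement.  The positivity of the
    determinant comes out of the same induction. *)
Lemma integral_gauss_Rn n (A : 'M[R]_n) : posdef A ->
  0 < \det A /\
  integral_Rn (fun x => (expR (- (qform A x / 2)))%:E) =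
    (Num.sqrt ((2 * pi) ^+ n / \det A))%:E.
Proof.
elim: n A => [|n IH] A Apd.
  rewrite det_mx00; split=> //; rewrite divr1 expr0 sqrtr1 /integral_Rn/=.
  rewrite integral_dirac//=; last exact: measurable_gauss.
  rewrite diracT mul1e; congr EFin.
  by rewrite qformE big_ord0 mul0r oppr0 expR0.
have a0 := posdef_corner Apd; have Spd := posdef_schur Apd.
have [dS IS] := IH _ Spd; have an0 : A 0 0 != 0 by rewrite gt_eqF.
rewrite (det_schur Apd.1 an0); split; first by rewrite mulr_gt0.
rewrite (@integral_Rn_recl n); last 2 first.
- by move=> x; rewrite lee_fin expR_ge0.
- exact: measurable_gauss.
transitivity (integral_Rn (fun t : 'cV[R]_n => (Num.sqrt (2 * pi / A 0 0))%:E *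
    (expR (- (qform (schur A) t / 2)))%:E)%E).
  congr integral_Rn; apply/funext => t.
  under eq_integral do rewrite (qform_schur _ _ Apd.1 an0) mulrDl opprD expRD EFinM.
  rewrite ge0_integralZr//.
  - by rewrite integral_gauss.
  - apply/measurable_EFinP; apply: measurableT_comp => //.
    apply: measurableT_comp => //; apply: measurable_funM => //.
    apply: measurable_funM => //; apply: measurable_funX.
    exact: measurable_funD.
rewrite /integral_Rn.
have [[m mE] _] := lebesgue_tuple_spec R n.
rewrite -mE ge0_integralZl_EFin//; last exact: measurable_gauss.
move: IS; rewrite /integral_Rn -mE => ->.
rewrite -EFinM -sqrtrM; last by rewrite divr_ge0// ?ltW// mulr_gt0// pi_gt0.
congr (Num.sqrt _)%:E; rewrite exprS; field.
by rewrite !gt_eqF.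
Qed.

End gaussian_integral.

(** * Expectation of the normalised integrand under the prior *)

Section gaussian_expectation.
Context (R : realType) (n : nat).
Notation tupleR := (n.-tuple (measurableTypeR R)).

Variable Omega : 'M[R]_n.
Hypothesis Omega_pd : posdef Omega.

Definition mvnormal_peak : R := (Num.sqrt ((2 * pi) ^+ n * \det Omega))^-1.

Lemma mvnormal_peak_ge0 : 0 <= mvnormal_peak.
Proof. by rewrite invr_ge0 sqrtr_ge0. Qed.

Lemma mvnormal_pdf0E (x : 'cV[R]_n) : mvnormal_pdf 0 Omega x =
  mvnormal_peak * expR (- (qform (invmx Omega) x / 2)).
Proof. by rewrite /mvnormal_pdf subr0. Qed.

Lemma measurable_mvnormal_pdf : measurable_fun setT
  (fun t : tupleR => (mvnormal_pdf 0 Omega (col_of_tuple t))%:E).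
Proof.
apply/measurable_EFinP; under eq_fun do rewrite mvnormal_pdf0E.
apply: measurable_funM => //; apply/measurable_EFinP.
exact: measurable_gauss.
Qed.

Lemma integral_mvnormal_pdf :
  integral_Rn (fun x => (mvnormal_pdf 0 Omega x)%:E) = 1%E.
Proof.
have [[m mE] _] := lebesgue_tuple_spec R n.
have [dW IW] := integral_gauss_Rn (posdef_invmx Omega_pd).
move: IW; rewrite /integral_Rn -mE => IW.
under eq_integral do rewrite mvnormal_pdf0E EFinM.
rewrite ge0_integralZl_EFin ?mvnormal_peak_ge0//; last exact: measurable_gauss.
rewrite [X in (_ * X)%E]IW -EFinM /mvnormal_peak det_inv invrK mulVf//.
rewrite gt_eqF// sqrtr_gt0 mulr_gt0 ?exprn_gt0 ?mulr_gt0 ?pi_gt0//.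
by rewrite det_inv invr_gt0 in dW.
Qed.

Lemma integrable_gauss (m : {measure set tupleR -> \bar R}) (A : 'M[R]_n) :
  (m : set _ -> _) = @lebesgue_tuple R n -> posdef A ->
  m.-integrable setT (fun t => (expR (- (qform A (col_of_tuple t) / 2)))%:E).
Proof.
move=> mE Apd; apply/integrableP; split; first exact: measurable_gauss.
under eq_integral do rewrite gee0_abs ?lee_fin ?expR_ge0//.
have [_] := integral_gauss_Rn Apd; rewrite /integral_Rn -mE => ->.
exact: ltry.
Qed.

Variables (M : 'M[R]_n) (a p : R) (h : nat -> 'cV[R]_n).
Hypotheses (M_pd : posdef M) (a_gt0 : 0 < a) (p_ge0 : 0 <= p).
Hypothesis h_infty : qform M (h k) @[k --> \oo] --> +oo.

Lemma shift_qform_gt0 (x : 'cV[R]_n) : 0 < a + qform M x.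
Proof. by rewrite ltr_wpDr ?posdef_qform_ge0. Qed.

Lemma scaled_ratioE (k : nat) (x : 'cV[R]_n) :
  (a + qform M (h k)) `^ p * (a + qform M (x - h k)) `^ (- p) =
  ((a + qform M (h k)) / (a + qform M (x - h k))) `^ p.
Proof. by rewrite powR_div ?shift_qform_gt0// ltW ?shift_qform_gt0. Qed.

(** By Young's inequality with d = 1 the ratio is at most 2 + 2 q(x) / a for all
    k, so its p-th power grows at most polynomially in x; half of the Gaussian
    exponent absorbs it. *)
Lemma gaussian_majorant : exists2 C : R, 0 <= C & forall k x,
  ((a + qform M (h k)) / (a + qform M (x - h k))) `^ p *
    mvnormal_pdf 0 Omega x <=
  C * expR (- (qform (2^-1 *: invmx Omega) x / 2)).
Proof.
have [K K0 MK] := qform_le_posdef M (posdef_invmx Omega_pd).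
(* chosen so that the exponential bound on the power costs at most w / 4 *)
pose e := a / (8 * (K + 1)).
have K8 : 0 < 8 * (K + 1) by rewrite mulr_gt0// ltr_wpDl.
have e0 : 0 < e by rewrite divr_gt0.
have [C C0 HC] := powR_le_expR p_ge0 e0.
exists (C * expR (e * 2) * mvnormal_peak).
  by rewrite !mulr_ge0 ?expR_ge0 ?mvnormal_peak_ge0// ltW.
move=> k x; set q := qform M x; set w := qform (invmx Omega) x.
have q0 : 0 <= q by exact: posdef_qform_ge0.
have w0 : 0 <= w by exact/posdef_qform_ge0/posdef_invmx.
set r := _ / _.
have r0 : 0 <= r by rewrite divr_ge0// ltW// shift_qform_gt0.
have r_le : r <= 2 + 2 * q / a.
  have := qform_ratio_le (h k - x) x M_pd a_gt0 ltr01.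
  rewrite subrK -(qformN _ (h k - x)) opprB -/r -/q invr1 => /le_trans; apply.
  apply: lerD; first by lra.
  rewrite -[1 + 1]/2; apply: ler_wpM2l; first by rewrite mulr_ge0.
  by rewrite lef_pV2 ?posrE ?shift_qform_gt0// lerDl posdef_qform_ge0.
have rp : r `^ p <= C * expR (e * 2) * expR (w / 4).
  have r2 : 0 <= 2 + 2 * q / a by exact: le_trans r_le.
  apply: (@le_trans _ _ ((2 + 2 * q / a) `^ p)).
    exact: ge0_ler_powR.
  apply: le_trans (HC _ r2) _.
  rewrite -[leRHS]mulrA ler_wpM2l ?(ltW C0)// -expRD ler_expR mulrDr lerD2l.
  have -> : e * (2 * q / a) = q / (4 * (K + 1)).
    by rewrite /e; field; rewrite !gt_eqF// ltr_wpDl.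
  rewrite ler_pdivrMr; last by rewrite mulr_gt0// ltr_wpDl.
  have -> : w / 4 * (4 * (K + 1)) = K * w + w by field.
  by apply: le_trans (MK x) _; rewrite lerDl.
rewrite mvnormal_pdf0E qform_scale -/w.
apply: le_trans (ler_wpM2r _ rp) _.
  by rewrite mulr_ge0 ?mvnormal_peak_ge0 ?expR_ge0.
have [P0 E0] : 0 <= mvnormal_peak /\ 0 <= C * expR (e * 2).
  by rewrite mvnormal_peak_ge0 mulr_ge0 ?expR_ge0// ltW.
rewrite mulrACA [expR (w / 4) * _]mulrC -expRD.
apply: ler_wpM2l; first exact: mulr_ge0.
by rewrite ler_expR; lra.
Qed.

(** Dominated convergence: the ratio tends to 1 pointwise, and the total mass of
    the prior is 1. *)
Lemma cvg_gaussian_expectation :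
  integral_Rn (fun x => ((a + qform M (h k)) `^ p *
    ((a + qform M (x - h k)) `^ (- p) * mvnormal_pdf 0 Omega x))%:E)
  @[k --> \oo] --> 1%E.
Proof.
have [[m mE] _] := lebesgue_tuple_spec R n.
rewrite -integral_mvnormal_pdf /integral_Rn -mE.
have [C C0 HC] := gaussian_majorant.
apply: (@dominated_cvg _ _ _ m setT measurableT _ _
  (fun t => C%:E * (expR (- (qform (2^-1 *: invmx Omega) (col_of_tuple t) / 2)))%:E)%E).
- move=> k; apply/measurable_EFinP; apply: measurable_funM => //.
  apply: measurable_funM; last first.
    by apply/measurable_EFinP; exact: measurable_mvnormal_pdf.
  apply: (measurableT_comp (measurable_powR _)).
  by apply: measurable_funD => //; exact: measurable_qform.
- move=> t _; apply/fine_cvgP; split; first exact: nearW.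
  pose x : 'cV[R]_n := col_of_tuple t.
  have : ((a + qform M (h k)) / (a + qform M (x - h k))) `^ p *
      mvnormal_pdf 0 Omega x @[k --> \oo] --> (1 * mvnormal_pdf 0 Omega x : R).
    apply: cvgM; last exact: cvg_cst.
    by apply: cvg_powR1; exact: qform_ratio_cvg.
  rewrite mul1r; apply: cvg_trans; apply: near_eq_cvg; apply: nearW => k /=.
  by rewrite mulrA scaled_ratioE.
- by move=> t _.
- by apply: integrableZl => //; apply: integrable_gauss => //;
    apply: posdefZ => //; exact: posdef_invmx.
- move=> k t _; rewrite mulrA scaled_ratioE gee0_abs ?lee_fin.
    exact: HC.
  by rewrite mulr_ge0 ?powR_ge0// mvnormal_pdf0E mulr_ge0
    ?mvnormal_peak_ge0 ?expR_ge0.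
Qed.

End gaussian_expectation.

(** * The Bayes factor *)

Section bayes_factor.
Context (R : realType).

Lemma qform_enorm_cvgy n (A : 'M[R]_n) (h : nat -> 'cV[R]_n) : posdef A ->
  (forall k, k%:R < enorm (h k)) -> qform A (h k) @[k --> \oo] --> +oo.
Proof.
move=> Apd hk; apply/cvgryPge => B; pose K := `|\tr (invmx A)| + 1.
have K0 : 0 < K by rewrite ltr_wpDl.
near=> k; apply: le_trans (ler_norm B) _.
rewrite -(ler_pM2l K0).
have Bk : K * `|B| <= k%:R.
  by near: k; exact: nbhs_infty_ger.
apply: (le_trans Bk).
have k2 : (k%:R : R) <= k%:R ^+ 2.
  by rewrite -natrX ler_nat; case: (k) => // m; rewrite leq_pmulr.
apply: (le_trans k2).
apply: (@le_trans _ _ (enorm (h k) ^+ 2)).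
  by rewrite ler_pXn2r ?nnegrE ?sqrtr_ge0// ltW.
rewrite sqr_sqrtr; last by apply: sumr_ge0 => i _; exact: sqr_ge0.
apply: le_trans (posdef_sumsq_le _ Apd) _.
apply: ler_wpM2r; first exact: posdef_qform_ge0.
by apply: le_trans (ler_norm _) _; rewrite lerDl.
Unshelve. all: by end_near. Qed.

Lemma invchi2_const_gt0 (s nu : R) : 0 < s -> 0 <= nu -> 0 < invchi2_const s nu.
Proof.
move=> s0 nu0; rewrite /invchi2_const; have [//|nuN0] := eqVneq nu 0.
have nu2 : 0 < nu / 2 by rewrite divr_gt0// lt_def nuN0.
by rewrite divr_gt0 ?Gamma_gt0// mulr_gt0 ?powR_gt0.
Qed.

(** For nu = 0 both sides are 1: the convention on the improper prior agrees with
    the value of the power. *)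
Lemma invchi2_const_ratio (s0 s1 nu : R) : 0 < s0 -> 0 < s1 -> 0 <= nu ->
  invchi2_const s1 nu / invchi2_const s0 nu = (s1 / s0) `^ nu.
Proof.
move=> s0_gt0 s1_gt0 nu_ge0; rewrite /invchi2_const.
have [->|nuN0] := eqVneq nu 0; first by rewrite divr1 powRr0.
have nu2 : 0 < nu / 2 by rewrite divr_gt0// lt_def nuN0.
have G0 := Gamma_gt0 nu2; have P0 : 0 < (nu / 2) `^ (nu / 2) by exact: powR_gt0.
have S0 : 0 < s0 `^ nu by exact: powR_gt0.
rewrite (powR_div _ (ltW s1_gt0) s0_gt0) powRN.
by field; rewrite !gt_eqF.
Qed.

(** The filter has a countable base, so that convergence can be tested along
    sequences, as dominated convergence requires. *)
Lemma cvg_thetahat_infty (n r1 r2 : nat) (Sigma : 'M[R]_n)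
    (Xt : 'M[R]_(n, r1)) (Xg : 'M[R]_(n, r2)) (c : R) (Y : topologicalType)
    (u : 'cV[R]_n -> Y) (l : Y) :
  (forall y : nat -> 'cV[R]_n,
     (forall k, ssr Sigma Xt Xg (y k) = c) ->
     (forall k, k%:R < enorm (gls Sigma Xt (y k))) ->
     u (y k) @[k --> \oo] --> l) ->
  u y @[y --> thetahat_infty Sigma Xt Xg c] --> l.
Proof.
move=> cvg_seq U Ul; apply: contrapT => notU.
have /choice[y Hy] : forall k : nat, exists y,
    [/\ ssr Sigma Xt Xg y = c, k%:R < enorm (gls Sigma Xt y) & ~ U (u y)].
  move=> k; apply: contrapT => noy; apply: notU; exists k%:R => // y [yc yk].
  by apply: contrapT => Uy; apply: noy; exists y.
have : \forall k \near \oo, U (u (y k)).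
  by apply: (cvg_seq y) => // k; have [] := Hy k.
by move=> [k _ /(_ k (leqnn k))]; have [_ _] := Hy k.
Qed.

Section fixed_design.
Variables (n r1 r2 : nat) (Sigma : 'M[R]_n).
Variables (Xt : 'M[R]_(n, r1)) (Xg : 'M[R]_(n, r2)) (Omega : 'M[R]_r1).
Variables (s0 nu0 s1 nu1 c : R).
Hypotheses (n_gt : (r1 + r2 < n)%N) (Sigma_pd : posdef Sigma).
Hypothesis full_rank : \rank (row_mx Xt Xg) = (r1 + r2)%N.
Hypothesis Omega_pd : posdef Omega.
Hypotheses (s0_gt0 : 0 < s0) (s1_gt0 : 0 < s1).
Hypotheses (nu0_ge0 : 0 <= nu0) (nu1_ge0 : 0 <= nu1).
Hypothesis base_gt0 : 0 < nu1 * s1 ^+ 2 + c.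

Let M := Xt^T *m invmx Sigma *m Xt.
Let a0 := nu0 * s0 ^+ 2 + c.
Let a1 := nu1 * s1 ^+ 2 + c.
Let expo (nu : R) := (n%:R - r2%:R + nu) / 2.

Lemma gram_posdef : posdef M.
Proof.
have [rXt _] := rank_row_mx_full full_rank.
exact: posdef_gram (posdef_invmx Sigma_pd) rXt.
Qed.

Lemma exponent_gt0 (nu : R) : 0 <= nu -> 0 < expo nu.
Proof.
move=> nu_ge0; rewrite divr_gt0// ltr_wpDr// subr_gt0 ltr_nat.
by apply: leq_ltn_trans n_gt; exact: leq_addl.
Qed.

Lemma Gamma_exponent_gt0 (nu : R) : 0 <= nu ->
  0 < Gamma ((n%:R + nu - r2%:R) / 2).
Proof.
move=> /exponent_gt0 e0; rewrite Gamma_gt0//; move: e0; rewrite /expo.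
by rewrite addrAC.
Qed.

Lemma C2_gt0 : 0 < C2 n r2 s0 nu0 s1 nu1.
Proof.
by rewrite /C2 !mulr_gt0 ?invr_gt0 ?powR_gt0 ?Gamma_exponent_gt0
  ?invchi2_const_gt0.
Qed.

(** The factor (a1 + q)^p1 is moved into the integral, where it normalises the
    integrand; what is left outside depends on the data only through q. *)
Lemma B10E (y : 'cV[R]_n) : ssr Sigma Xt Xg y = c ->
  let q := qform M (gls Sigma Xt y) in
  B10 Sigma Xt Xg Omega s0 nu0 s1 nu1 y =
  ((C2 n r2 s0 nu0 s1 nu1 * ((a0 + q) `^ expo nu0 / (a1 + q) `^ expo nu1))%:E *
   integral_Rn (fun x => ((a1 + q) `^ expo nu1 *
     ((a1 + qform M (x - gls Sigma Xt y)) `^ (- expo nu1)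
       * mvnormal_pdf 0 Omega x))%:E))%E.
Proof.
move=> yc q; rewrite /B10 yc -/M -/a0 -/a1 -/q -/(expo nu0) -/(expo nu1).
have a1q : 0 < a1 + q by exact: shift_qform_gt0 gram_posdef base_gt0 _.
rewrite powRN invrK.
pose F (x : 'cV[R]_r1) := (a1 + qform M (x - gls Sigma Xt y)) `^ (- expo nu1)
       * mvnormal_pdf 0 Omega x.
have F0 x : 0 <= F x.
  by rewrite mulr_ge0 ?powR_ge0// mvnormal_pdf0E mulr_ge0
    ?mvnormal_peak_ge0 ?expR_ge0.
have [[m mE] _] := lebesgue_tuple_spec R r1.
have -> : integral_Rn (fun x => ((a1 + q) `^ expo nu1 * F x)%:E) =
    (((a1 + q) `^ expo nu1)%:E * integral_Rn (fun x => (F x)%:E))%E.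
  rewrite /integral_Rn -mE; under eq_integral do rewrite EFinM.
  rewrite ge0_integralZl_EFin ?powR_ge0//.
    by move=> t _; rewrite lee_fin.
  apply/measurable_EFinP; apply: measurable_funM; last first.
    by apply/measurable_EFinP; exact: measurable_mvnormal_pdf.
  apply: (measurableT_comp (measurable_powR _)).
  by apply: measurable_funD => //; exact: measurable_qform.
rewrite [in RHS]muleA -EFinM -[in RHS]mulrA divfK ?gt_eqF ?powR_gt0//.
by rewrite EFinM -muleA; congr (_ * _)%E; rewrite muleC.
Qed.

(** The normalised integral tends to 1, which leaves the prefactor; a product with
    the limit 1 is determinate even when the prefactor diverges. *)
Lemma B10_cvg (L : \bar R) :
  (forall x : nat -> R, x k @[k --> \oo] --> +oo ->
    (C2 n r2 s0 nu0 s1 nu1 *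
      ((a0 + x k) `^ expo nu0 / (a1 + x k) `^ expo nu1))%:E
    @[k --> \oo] --> L) ->
  B10 Sigma Xt Xg Omega s0 nu0 s1 nu1 y
    @[y --> thetahat_infty Sigma Xt Xg c] --> L.
Proof.
move=> quotient; apply: cvg_thetahat_infty => y yc yk.
have hoo := qform_enorm_cvgy gram_posdef yk.
rewrite -[L]mule1; under eq_cvg do rewrite B10E//.
apply: cvgeM; [by rewrite mule_defE onee_eq0 /= andbF|exact: quotient|].
apply: cvg_gaussian_expectation => //; first exact: gram_posdef.
exact/ltW/exponent_gt0.
Qed.

End fixed_design.
End bayes_factor.

Theorem lemma4 (R : realType) (n r1 r2 : nat) (Sigma : 'M[R]_n)
    (Xt : 'M[R]_(n, r1)) (Xg : 'M[R]_(n, r2)) (Omega : 'M[R]_r1)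
    (s0 nu0 s1 nu1 c : R)
    (r1_ge1 : (1 <= r1)%N)
    (n_gt : (r1 + r2 < n)%N)
    (Sigma_pd : posdef Sigma)
    (full_rank : \rank (row_mx Xt Xg) = (r1 + r2)%N)
    (orth : Xt^T *m invmx Sigma *m Xg = 0)
    (Omega_pd : posdef Omega)
    (s0_gt0 : 0 < s0) (s1_gt0 : 0 < s1)
    (nu0_ge0 : 0 <= nu0) (nu1_ge0 : 0 <= nu1)
    (base_gt0 : 0 < nu1 * s1 ^+ 2 + c) :
  [/\ nu0 < nu1 ->
        B10 Sigma Xt Xg Omega s0 nu0 s1 nu1 y
          @[y --> thetahat_infty Sigma Xt Xg c] --> 0%:E,
      nu0 = nu1 ->
        B10 Sigma Xt Xg Omega s0 nu0 s1 nu1 y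
          @[y --> thetahat_infty Sigma Xt Xg c] --> ((s1 / s0) `^ nu1)%:E,
      nu0 = nu1 -> s0 = s1 \/ nu1 = 0 ->
        B10 Sigma Xt Xg Omega s0 nu0 s1 nu1 y
          @[y --> thetahat_infty Sigma Xt Xg c] --> 1%:E
    & nu1 < nu0 ->
        B10 Sigma Xt Xg Omega s0 nu0 s1 nu1 y
          @[y --> thetahat_infty Sigma Xt Xg c] --> +oo%E].
Proof.
have cvg_B10 := B10_cvg n_gt Sigma_pd full_rank Omega_pd nu1_ge0 base_gt0.
have C2_pos := C2_gt0 n_gt s0_gt0 s1_gt0 nu0_ge0 nu1_ge0.
have expoE nu nu' : nu < nu' ->
    (n%:R - r2%:R + nu) / 2 < (n%:R - r2%:R + nu') / 2 :> R.
  by move=> lt_nu; rewrite ltr_pM2r// ltrD2l.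
have cvg_eq : nu0 = nu1 -> B10 Sigma Xt Xg Omega s0 nu0 s1 nu1 y
    @[y --> thetahat_infty Sigma Xt Xg c] --> ((s1 / s0) `^ nu1)%:E.
  move=> nu01; apply: cvg_B10 => x xoo.
  have <- : C2 n r2 s0 nu0 s1 nu1 = (s1 / s0) `^ nu1.
    rewrite /C2 nu01 invchi2_const_ratio// subrr mul0r powRr0 mulr1.
    by rewrite mulfV ?mulr1// gt_eqF// (Gamma_exponent_gt0 n_gt).
  rewrite nu01; apply/fine_cvgP; split; first exact: nearW.
  rewrite -[X in _ --> X]mulr1; apply: cvgM; first exact: cvg_cst.
  exact: cvg_quotient1.
split=> //.
- move=> nu01; apply: cvg_B10 => x xoo.
  apply/fine_cvgP; split; first exact: nearW.
  rewrite -[X in _ --> X](mulr0 (C2 n r2 s0 nu0 s1 nu1)).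
  by apply: cvgM; [exact: cvg_cst|apply: cvg_quotient0 => //; exact: expoE].
- move=> nu01 s01; have -> : 1 = (s1 / s0) `^ nu1; last exact: cvg_eq.
  case: s01 => [->|->]; last by rewrite powRr0.
  by rewrite divff ?gt_eqF// powR1.
- move=> nu10; apply: cvg_B10 => x xoo.
  apply/cvgeryP/cvgryPge => A.
  have /cvgryPge/(_ (A / C2 n r2 s0 nu0 s1 nu1)) :=
    cvg_quotienty (nu0 * s0 ^+ 2 + c) (nu1 * s1 ^+ 2 + c) xoo (expoE _ _ nu10).
  by apply: filterS => k; rewrite ler_pdivrMr// mulrC.
Qed.
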